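(* Let $A,B,C\in\mathcal{M}_n(\mathbb{C})$ be such that $\{A,B,C\}$ is a commuting set of diagonalizable matrices, and consider the Sylvester equation $$(E)\qquad AX+XB=C$$ with unknown $X\in\mathcal{M}_n(\mathbb{C})$. Let $\widehat{X}=(A+B)^{\mathbf{D}}C$. The following statements hold. (i) $\widehat{X}$ is a diagonalizable matrix that commutes with all the matrices in the set $\{A,B,C\}$. If $A,B,C$ are normal matrices, then $\widehat{X}=(A+B)^{\dagger}C$ and this is a normal matrix. (ii) Any of the following conditions is a necessary and sufficient condition for the consistency of $(E)$: (a) $\widehat{X}$ is a solution of $(E)$; (b) the standard linear equation $(A+B)X=C$ is consistent; (c) $\widehat{X}$ is a solution of the standard linear equation $(A+B)X=C$. (iii) If $(E)$ is consistent and $(\mathbf{a}=(a_1,\dots,a_n),\mathbf{b}=(b_1,\dots,b_n))$ is a sequence of induced vectors by $(A,B)$, then (a) the dimension of the affine set of solutions of $(E)$ is equal to the cardinality of $\{(r,s)\in\{1,\dots,n\}^2\mid a_r+b_s=0\}$; (b) the condition that $a_r+b_s\neq 0$ whenever $r\neq s$ is sufficient for all solutions of $(E)$ to be diagonalizable matrices. (iv) If $A+B$ is invertible, then $\widehat{X}=(A+B)^{-1}C$ is a solution of $(E)$. In addition, if $X\neq\widehat{X}$ is a solution of $(E)$, then $AX\neq XA$ and $BX\neq XB$. (v) If $(E)$ is consistent and $A+B$ is not invertible, then $(E)$ has an infinite number of solutions.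
   Context: $\mathcal{M}_n(\mathbb{C})$ is the set of complex $n\times n$ matrices. A set of matrices is commuting if any two of its elements commute. An equation is consistent if it has at least one solution. $M$ is normal if $MM^\star=M^\star M$, where $M^\star$ is the conjugate transpose. A pair $(\mathbf{a},\mathbf{b})\in\mathbb{C}^n\times\mathbb{C}^n$ is a sequence of induced vectors by $(A,B)$ if there is an invertible $S\in\mathcal{M}_n(\mathbb{C})$ with $S^{-1}AS=\mathrm{diag}(\mathbf{a})$ and $S^{-1}BS=\mathrm{diag}(\mathbf{b})$. $M^{\dagger}$ denotes the Moore–Penrose inverse. The Drazin inverse $M^{\mathbf{D}}$ of $M\in\mathcal{M}_n(\mathbb{C})$ is the unique matrix with $M^{p+1}M^{\mathbf{D}}=M^{p}$, $M^{\mathbf{D}}MM^{\mathbf{D}}=M^{\mathbf{D}}$, $M^{\mathbf{D}}M=MM^{\mathbf{D}}$, where $p=\mathrm{ind}(M)$ is the least nonnegative integer with $\mathrm{rank}(M^{p+1})=\mathrm{rank}(M^p)$. *)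

(* Defs.v *)
From HB Require Import structures.
From mathcomp Require Import all_boot all_order all_algebra.
From mathcomp Require Import classical_sets.

Set Implicit Arguments.
Unset Strict Implicit.
Unset Printing Implicit Defensive.

Import Order.TTheory GRing.Theory Num.Theory Num.Def.
Local Open Scope ring_scope.
Local Open Scope sesquilinear_scope.

Section DrazinRing.
Variables (T : pzRingType) (m : T) (k : nat).

Lemma exp_left_inv (w : T) j :
  m ^+ k = w * m ^+ k.+1 -> m ^+ k = w ^+ j * m ^+ (k + j).
Proof.
move=> e; elim: j => [|j IH]; first by rewrite addn0 mul1r.
by rewrite exprSr addnS -addSn exprD -mulrA [w * _]mulrA -e -exprD.
Qed.

Lemma exp_right_inv (v : T) j :
  m ^+ k = m ^+ k.+1 * v -> m ^+ k = m ^+ (k + j) * v ^+ j.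
Proof.
move=> e; elim: j => [|j IH]; first by rewrite addn0 mulr1.
rewrite exprS addnS -addSn addnC exprD -mulrA [m ^+ k.+1 * _]mulrA -e.
by rewrite mulrA -exprD addnC.
Qed.

Lemma drazin_ring_exists (w v : T) :
  m ^+ k = w * m ^+ k.+1 -> m ^+ k = m ^+ k.+1 * v ->
  exists d, [/\ m ^+ k.+1 * d = m ^+ k, d * m * d = d & d * m = m * d].
Proof.
move=> /(exp_left_inv k.+1); move: (w ^+ k.+1) => {}w ew.
move=> /(exp_right_inv k.+1); move: (v ^+ k.+1) => {}v ev.
have e : w * m ^+ k = m ^+ k * v by rewrite {1}ev mulrA -ew.
have c : w * m ^+ k * m = m * (m ^+ k * v).
  rewrite -mulrA -exprSr exprS {1}ev !mulrA -[w * m * _]mulrA -exprS.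
  by rewrite exprSr mulrA -ew -exprSr exprS.
exists (w * m ^+ k); split.
- by rewrite e mulrA -exprD addnC -ev.
- have p : m ^+ k * m * m ^+ k = m ^+ (k + k.+1).
    by rewrite -exprSr -exprD addSnnS.
  by rewrite {2}e !mulrA -[w * _ * m]mulrA -[w * _ * m ^+ k]mulrA p -ew -e.
- by rewrite c e.
Qed.

Lemma drazin_ring_unique (d d' : T) :
  [/\ m ^+ k.+1 * d = m ^+ k, d * m * d = d & d * m = m * d] ->
  [/\ m ^+ k.+1 * d' = m ^+ k, d' * m * d' = d' & d' * m = m * d'] ->
  d = d'.
Proof.
move=> [d1 d2 d3] [d1' d2' d3'].
have l : d = d * m * d'.
  have h j : d = d ^+ j.+1 * m ^+ j.
    elim: j => [|j IH]; first by rewrite mulr1.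
    rewrite exprS [m ^+ j.+1]exprSr mulrA -[d * _ * m ^+ j]mulrA -IH.
    by rewrite -mulrA d3 mulrA d2.
  by rewrite {1}(h k) -d1' [m ^+ k.+1]exprSr !mulrA -(h k).
have r : d' = d * m * d'.
  have h j : d' = m ^+ j * d' ^+ j.+1.
    elim: j => [|j IH]; first by rewrite mul1r.
    rewrite exprS [d' ^+ j.+2]exprSr mulrA -[m * _ * d' ^+ j.+1]mulrA -IH.
    by rewrite -d3' d2'.
  have c : m ^+ k.+1 * d = d * m ^+ k.+1 by apply/esym/commrX.
  by rewrite {1}(h k) -d1 c [m ^+ k.+1]exprS -!mulrA -(h k).
by rewrite l -r.
Qed.
End DrazinRing.

Section Drazin.
Context {F : fieldType} {n : nat}.
Implicit Types M D : 'M[F]_n.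

Lemma mxindex_exists M : exists p, \rank (M ^+ p.+1) == \rank (M ^+ p).
Proof.
have rank_dec p : (\rank (M ^+ p.+1) <= \rank (M ^+ p))%N.
  by rewrite exprS mxrankM_maxr.
have H p : (exists q, \rank (M ^+ q.+1) == \rank (M ^+ q)) \/
           (\rank (M ^+ p) + p <= n)%N.
  elim: p => [|p [|IH]]; [by right; rewrite addn0 rank_leq_row|by left|].
  have [e|ne] := eqVneq (\rank (M ^+ p.+1)) (\rank (M ^+ p)).
    by left; exists p; apply/eqP.
  right; apply: leq_trans IH; rewrite addnS -addSn leq_add2r.
  by rewrite ltn_neqAle ne rank_dec.
by case: (H n.+1) => // /(leq_trans (leq_addl _ _)); rewrite ltnn.
Qed.

(* Square matrices of any size, including 0, form a pzRing, so M ^+ p is the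
   matrix power and M ^+ 0 = 1%:M. *)
Definition mxindex M : nat := ex_minn (mxindex_exists M).

Definition is_drazin M D : bool :=
  [&& M ^+ (mxindex M).+1 *m D == M ^+ mxindex M,
      D *m M *m D == D & D *m M == M *m D].

Lemma is_drazinP M D : reflect
  [/\ M ^+ (mxindex M).+1 * D = M ^+ mxindex M, D * M * D = D & D * M = M * D]
  (is_drazin M D).
Proof. by apply: (iffP and3P) => -[/eqP? /eqP? /eqP?]; split=> //; apply/eqP. Qed.

Lemma rank_factor p (U V : 'M[F]_(n, p)) (W : 'M[F]_n) :
  U = W *m V -> \rank U = \rank V -> exists X, V = X *m U.
Proof.
move=> e rk; have sub : (U <= V)%MS by rewrite e submxMl.
by apply/submxP; rewrite -(geq_leqif (mxrank_leqif_sup sub)) rk.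
Qed.

Lemma drazin_exists M : exists D, is_drazin M D.
Proof.
have /eqP rk : \rank (M ^+ (mxindex M).+1) == \rank (M ^+ mxindex M).
  by rewrite /mxindex; case: ex_minnP.
have [w ew] := rank_factor (exprS M (mxindex M)) rk.
have [v ev] : exists v, (M ^+ mxindex M)^T = v *m (M ^+ (mxindex M).+1)^T.
  by apply: (@rank_factor _ _ _ M^T); rewrite ?mxrank_tr// exprSr trmx_mul.
have {}ev : M ^+ mxindex M = M ^+ (mxindex M).+1 *m v^T.
  by rewrite -[LHS]trmxK ev trmx_mul trmxK.
by have [d dP] := drazin_ring_exists ew ev; exists d; apply/is_drazinP.
Qed.

(* The choice is immaterial, by drazinmx_unique. *)
Definition drazinmx M : 'M[F]_n := xchoose (drazin_exists M).

Lemma drazinmxP M : is_drazin M (drazinmx M).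
Proof. exact: xchooseP. Qed.

Lemma drazinmx_unique M D : is_drazin M D -> D = drazinmx M.
Proof.
by move=> /is_drazinP d; apply: (drazin_ring_unique d); apply/is_drazinP/drazinmxP.
Qed.
End Drazin.

Section MoorePenrose.
Context {C : numClosedFieldType}.

(* The four Penrose equations; _ ^t* is the conjugate transpose. *)
Definition is_mpinv m n (M : 'M[C]_(m, n)) (X : 'M[C]_(n, m)) : bool :=
  [&& M *m X *m M == M, X *m M *m X == X,
      (M *m X)^t* == M *m X & (X *m M)^t* == X *m M].

Lemma adjM m n p (U : 'M[C]_(m, n)) (V : 'M[C]_(n, p)) :
  (U *m V)^t* = V^t* *m U^t*.
Proof. by rewrite trmx_mul map_mxM. Qed.

Lemma gram0 m n (U : 'M[C]_(m, n)) : U *m U^t* = 0 -> U = 0.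
Proof.
move=> e; apply/matrixP=> i j; rewrite [RHS]mxE.
have := congr1 (fun N : 'M_m => N i i) e; rewrite !mxE => /eqP.
rewrite psumr_eq0 => [/allP/(_ j)|l _]; rewrite !mxE ?mul_conjC_ge0//.
by rewrite mem_index_enum mul_conjC_eq0 => /(_ isT)/eqP.
Qed.

Lemma gram_unit m n (U : 'M[C]_(m, n)) : row_free U -> U *m U^t* \in unitmx.
Proof.
move=> fU; rewrite -row_free_unit -kermx_eq0; set K := kermx _.
rewrite -(mulmx_free_eq0 _ fU); apply/eqP/gram0.
by rewrite adjM !mulmxA -[K *m U *m _]mulmxA mulmx_ker mul0mx.
Qed.

Lemma adj_inv n (U : 'M[C]_n) : (invmx U)^t* = invmx (U^t*).
Proof. by rewrite trmx_inv map_invmx. Qed.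

Lemma mpinv_exists m n (M : 'M[C]_(m, n)) : exists X, is_mpinv M X.
Proof.
have [r [F [G [eM fF fG]]]] : exists r (F : 'M[C]_(m, r)) (G : 'M[C]_(r, n)),
    [/\ M = F *m G, row_free (F^t*) & row_free G].
  exists (\rank M), (col_base M), (row_base M); split.
  - by rewrite mulmx_base.
  - by rewrite row_free_map /row_free mxrank_tr; exact: col_base_full.
  - exact: row_base_free.
have uG : G *m G^t* \in unitmx by exact: gram_unit.
have uF : F^t* *m F \in unitmx by rewrite -[X in _ *m X]trmxCK; exact: gram_unit.
pose gi := invmx (G *m G^t*); pose fi := invmx (F^t* *m F).
have hgi : gi^t* = gi by rewrite adj_inv adjM trmxCK.
have hfi : fi^t* = fi by rewrite adj_inv adjM trmxCK.
pose X := G^t* *m gi *m fi *m F^t*.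
have MX : M *m X = F *m fi *m F^t*.
  by rewrite eM /X !mulmxA -(mulmxA F) -(mulmxA F) mulmxV ?mulmx1.
have XM : X *m M = G^t* *m gi *m G.
  rewrite eM /X !mulmxA -(mulmxA _ _ F) -[_ *m fi *m _]mulmxA mulVmx //.
  by rewrite mulmx1.
exists X; apply/and4P; split; apply/eqP.
- by rewrite MX {1}eM !mulmxA -(mulmxA _ _ F) -[_ *m fi *m _]mulmxA mulVmx ?mulmx1.
- rewrite XM /X !mulmxA -(mulmxA _ G) -[_ *m gi *m (_ *m _)]mulmxA mulVmx //.
  by rewrite mulmx1.
- by rewrite MX !adjM trmxCK hfi mulmxA.
- by rewrite XM !adjM trmxCK hgi mulmxA.
Qed.

(* The choice is immaterial, by mpinvmx_unique. *)
Definition mpinvmx m n (M : 'M[C]_(m, n)) : 'M[C]_(n, m) :=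
  xchoose (mpinv_exists M).

Lemma mpinvmxP m n (M : 'M[C]_(m, n)) : is_mpinv M (mpinvmx M).
Proof. exact: xchooseP. Qed.

Lemma mpinvmx_unique m n (M : 'M[C]_(m, n)) X : is_mpinv M X -> X = mpinvmx M.
Proof.
move: (mpinvmx M) (mpinvmxP M) => Y.
move=> /and4P[/eqP y1 /eqP y2 /eqP y3 /eqP y4].
move=> /and4P[/eqP x1 /eqP x2 /eqP x3 /eqP x4].
have l : M *m X = M *m Y.
  by rewrite -{1}y1 -mulmxA -y3 -x3 -adjM mulmxA x1 y3.
have r : X *m M = Y *m M.
  rewrite -{1}y1 -!mulmxA mulmxA -y4 -x4 -adjM -!mulmxA.
  by rewrite [M *m (X *m M)]mulmxA x1 y4.
by rewrite -x2 -mulmxA l mulmxA r y2.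
Qed.
End MoorePenrose.

Definition induced_vectors (F : fieldType) n (A B : 'M[F]_n) (a b : 'rV[F]_n) :=
  exists2 S, S \in unitmx &
    invmx S *m A *m S = diag_mx a /\ invmx S *m B *m S = diag_mx b.

(* S is an affine subspace whose direction U has dimension d; in particular S
   is nonempty, and d is determined by S. *)
Definition affine_dim (F : fieldType) (V : vectType F) (S : set V) (d : nat) :=
  exists x0, exists2 U : {vspace V},
    S = [set x | x - x0 \in U]%classic & \dim U = d.

(* Main.v *)
Require Import Defs.
From HB Require Import structures.
From mathcomp Require Import all_boot all_order all_algebra.
From mathcomp Require Import classical_sets cardinality reals.
From mathcomp.real_closed Require Import complex.

(* In a common eigenbasis with eigenvalues a, b, c of A, B, C the equation reads
   (a_r + b_s) Y_rs = c_r [r = s]; it is solvable iff c_r = 0 whenever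
   a_r + b_r = 0, its solutions are free exactly in the entries with
   a_r + b_s = 0, and the Drazin inverse of A + B is diagonal with entries
   (a_r + b_r)^-1 (where 0^-1 = 0). Everything commuting with A + B commutes with
   this inverse and, for normal A, everything commuting with A commutes with its
   adjoint (Fuglede), for the same reason: both are polynomials in the given
   diagonalizable matrix. For (iii)(b), the difference Z of a solution and Xhat
   is diagonal in the eigenbasis and is annihilated by A + B, hence Z Xhat = 0 and
   Z + Xhat is diagonalizable. *)

Set Implicit Arguments.
Unset Strict Implicit.
Unset Printing Implicit Defensive.

Import Order.TTheory GRing.Theory Num.Theory.
Local Open Scope classical_set_scope.
Local Open Scope ring_scope.
Local Open Scope complex_scope.

(** * Matrices diagonal in a fixed basis and their Drazin inverses *)

Section DiagonalConjugates.
Context {F : fieldType} {n : nat}.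
Implicit Types (A M N P X Y : 'M[F]_n) (d : 'rV[F]_n).

Lemma diagonalizable_conj A : diagonalizable A <->
  exists2 P, P \in unitmx & exists d, A = invmx P *m diag_mx d *m P.
Proof.
split=> -[P uP].
  by case/(similar_diagLR uP) => d ->; exists P; last exists d; rewrite ?conjVmx.
by case=> d ->; exists P => //; apply/(similar_diagLR uP); exists d; rewrite conjVmx.
Qed.

Lemma mulmx_conj P M N : P \in unitmx ->
  (invmx P *m M *m P) *m (invmx P *m N *m P) = invmx P *m (M *m N) *m P.
Proof. by move=> uP; rewrite !mulmxA mulmxK. Qed.

Lemma conjmx_inj P M N : P \in unitmx ->
  invmx P *m M *m P = invmx P *m N *m P -> M = N.
Proof.
move=> uP /(congr1 (fun Z => P *m Z *m invmx P)).
by rewrite !mulmxA !mulmxV// !mul1mx -!mulmxA !mulmxV// !mulmx1.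
Qed.

Lemma conjmx_ex P X : P \in unitmx -> exists Y, X = invmx P *m Y *m P.
Proof.
move=> uP; exists (P *m X *m invmx P).
by rewrite !mulmxA mulVmx// mul1mx mulmxKV.
Qed.

(* [P^-1 diag(f d) P] is a polynomial in [P^-1 diag(d) P], hence commutes with
   whatever the latter commutes with. *)
Lemma comm_conj_map_diag P d (f : F -> F) N : P \in unitmx ->
  comm_mx (invmx P *m diag_mx d *m P) N ->
  comm_mx (invmx P *m diag_mx (map_mx f d) *m P) N.
Proof.
move=> uP; have [Y ->] := conjmx_ex N uP.
rewrite /comm_mx !mulmx_conj// => /(conjmx_inj uP)/matrixP e.
congr (_ *m _ *m _); apply/matrixP => i j; move: (e i j).
rewrite !mul_diag_mx !mul_mx_diag !mxE => {}e.
(* In place of an interpolating polynomial: [e] says (d_i - d_j) Y_ij = 0, so either f(d_i) = f(d_j)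
   or Y_ij = 0. *)
have [->|ne] := eqVneq (d 0 i) (d 0 j); first by rewrite mulrC.
suff -> : Y i j = 0 by rewrite mul0r mulr0.
apply/eqP; have /eqP := e; rewrite [_ * d 0 j]mulrC -subr_eq0 -mulrBl mulf_eq0.
by rewrite subr_eq0 (negPf ne).
Qed.

Lemma mulmx_diag_inv d :
  diag_mx d *m diag_mx (map_mx GRing.inv d) *m diag_mx d = diag_mx d.
Proof.
rewrite !mulmx_diag; congr diag_mx; apply/rowP => i; rewrite !mxE.
by have [->|nz] := eqVneq (d 0 i) 0; rewrite ?mulr0// mulfV// mul1r.
Qed.

(** The group inverse equations yield M^(p+1) N = M^p for every p > 0, whatever the index is. Index
    0 is treated apart: there [M] has full rank, hence is invertible. *)
Lemma drazinmx_group_inverse M N : M *m N *m M = M -> N *m M *m N = N ->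
  N *m M = M *m N -> N = drazinmx M.
Proof.
move=> MNM NMN cNM; apply/drazinmx_unique/is_drazinP; split=> //.
rewrite /mxindex; case: ex_minnP => -[|p] /eqP rk _.
  rewrite expr1 expr0 in rk *.
  have uM : M \in unitmx by rewrite -row_full_unit /row_full rk mxrank1.
  by rewrite -[LHS](mulmxK uM) -[RHS](mulmxV uM); congr (_ *m _).
have {}cNM : N * M = M * N by exact: cNM.
have {}MNM : M * N * M = M by exact: MNM.
by rewrite !exprSr -!mulrA -cNM [M * (N * M)]mulrA MNM.
Qed.

Lemma drazinmx_conj_diag P d : P \in unitmx ->
  drazinmx (invmx P *m diag_mx d *m P) =
  invmx P *m diag_mx (map_mx GRing.inv d) *m P.
Proof.
move=> uP; apply/esym/drazinmx_group_inverse; rewrite !mulmx_conj//.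
- by rewrite mulmx_diag_inv.
(* Inversion is an involution even at 0, so [mulmx_diag_inv] also applies to the inverted vector. *)
- have {2}-> : d = map_mx GRing.inv (map_mx GRing.inv d).
    by apply/rowP => i; rewrite !mxE invrK.
  by rewrite mulmx_diag_inv.
- by rewrite diag_mxC.
Qed.


End DiagonalConjugates.

(** * Commuting diagonalizable matrices *)

Section Diagonalizable.
Context {F : fieldType} {n : nat}.
Implicit Types (A B C M N X Z : 'M[F]_n).

Lemma comm_diagonalizableDM M N :
  comm_mx M N -> diagonalizable M -> diagonalizable N ->
  diagonalizable (M + N) /\ diagonalizable (M *m N).
Proof.
move=> cMN dM dN; have [|P uP /and3P[]] := (codiagonalizableP [:: M; N]).1.
  split=> [f g|f]; rewrite !inE; last by case/orP => /eqP->.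
  by move=> /orP[] /eqP-> /orP[] /eqP->.
move=> /(similar_diagLR uP)[d ->] /(similar_diagLR uP)[e ->] _.
rewrite !conjVmx// mulmx_conj// -mulmxDl -mulmxDr -linearD mulmx_diag.
by split; apply/diagonalizable_conj; exists P => //; eexists.
Qed.

Lemma comm_drazinmx M N : diagonalizable M -> comm_mx M N ->
  comm_mx (drazinmx M) N.
Proof.
move=> /diagonalizable_conj[P uP [d ->]]; rewrite drazinmx_conj_diag//.
exact: comm_conj_map_diag.
Qed.

Lemma diagonalizable_drazinmx M : diagonalizable M -> diagonalizable (drazinmx M).
Proof.
move=> /diagonalizable_conj[P uP [d ->]]; rewrite drazinmx_conj_diag//.
by apply/diagonalizable_conj; exists P => //; eexists.
Qed.

(** This fails for a nonzero nilpotent matrix, whose Drazin inverse is 0; on a diagonal it reduces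
    to x x^-1 x = x, true at x = 0 too. *)
Lemma diagonalizable_mul_drazinmxK M : diagonalizable M ->
  M *m drazinmx M *m M = M.
Proof.
move=> /diagonalizable_conj[P uP [d ->]]; rewrite drazinmx_conj_diag//.
by rewrite !mulmx_conj// mulmx_diag_inv.
Qed.

(* The diagonal part, in a common eigenbasis, of a solution of the Sylvester
   equation solves the standard one. *)
Lemma sylvester_standard A B C X : comm_mx A B -> comm_mx A C -> comm_mx B C ->
  diagonalizable A -> diagonalizable B -> diagonalizable C ->
  A *m X + X *m B = C -> exists Y, (A + B) *m Y = C.
Proof.
move=> cAB cAC cBC dA dB dC.
have [|P uP /and4P[]] := (codiagonalizableP [:: A; B; C]).1.
  split=> [f g|f]; rewrite !inE; last by case/or3P => /eqP->.
  by move=> /or3P[] /eqP-> /or3P[] /eqP->.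
move=> /(similar_diagLR uP)[a ->] /(similar_diagLR uP)[b ->].
move=> /(similar_diagLR uP)[c ->] _; rewrite !conjVmx//.
have [Y ->] := conjmx_ex X uP.
rewrite !mulmx_conj// -mulmxDl -mulmxDr => /(conjmx_inj uP)/matrixP e.
exists (invmx P *m diag_mx (\row_i Y i i) *m P).
rewrite -mulmxDl -mulmxDr mulmx_conj//; congr (_ *m _ *m _).
rewrite -linearD mulmx_diag; congr diag_mx; apply/rowP => i.
have := e i i; rewrite mul_diag_mx mul_mx_diag !mxE eqxx mulr1n => <-.
by rewrite mulrDl [b 0 i * _]mulrC.
Qed.

(** * The Sylvester operator in a common eigenbasis *)

Section InducedVectors.
Context (A B S : 'M[F]_n) (a b : 'rV[F]_n).
Hypotheses (uS : S \in unitmx) (eA : invmx S *m A *m S = diag_mx a)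
  (eB : invmx S *m B *m S = diag_mx b).

Let sylvester_conj Y r s : (invmx S *m (A *m (S *m Y *m invmx S) +
  (S *m Y *m invmx S) *m B) *m S) r s = (a 0 r + b 0 s) * Y r s.
Proof.
rewrite mulmxDr mulmxDl !mulmxA.
rewrite eA mulmxKV// mulVmx// mul1mx -(mulmxA Y) -(mulmxA Y) eB.
by rewrite mxE mul_diag_mx mul_mx_diag !mxE mulrDl [Y r s * _]mulrC.
Qed.

Lemma sylvester_kernelP Z : A *m Z + Z *m B = 0 <->
  forall r s, a 0 r + b 0 s != 0 -> (invmx S *m Z *m S) r s = 0.
Proof.
set Y := invmx S *m Z *m S.
have eZ : Z = S *m Y *m invmx S.
  by rewrite !mulmxA mulmxV// mul1mx mulmxK.
split=> [e r s nz|h].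
  have := sylvester_conj Y r s; rewrite -eZ e mulmx0 mul0mx [LHS]mxE => /esym/eqP.
  by rewrite mulf_eq0 (negPf nz) => /eqP.
have eS : invmx S *m (A *m Z + Z *m B) *m S = 0.
  apply/matrixP => r s; rewrite eZ sylvester_conj [RHS]mxE.
  by have [->|nz] := eqVneq (a 0 r + b 0 s) 0; rewrite ?mul0r// h// mulr0.
by apply: (conjmx_inj uS); rewrite eS mulmx0 mul0mx.
Qed.

Lemma sylvester_affine_dim C X0 : A *m X0 + X0 *m B = C ->
  affine_dim [set X | A *m X + X *m B = C]
    #|[set rs : 'I_n * 'I_n | a 0 rs.1 + b 0 rs.2 == 0]%SET|.
Proof.
move=> e0; set J := [set rs | _]%SET.
(* In the eigenbasis these are the matrix units at the positions in [J]; they form a basis of the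
   homogeneous solutions. *)
pose v (i : 'I_#|J|) := S *m delta_mx (enum_val i).1 (enum_val i).2 *m invmx S.
have [V nV] : exists V : #|J|.-tuple 'M[F]_n, forall i : 'I_#|J|, V`_i = v i.
  by exists [tuple v i | i < #|J|] => i; rewrite -tnth_nth tnth_mktuple.
have KE (k : 'I_#|J| -> F) r s :
    (invmx S *m (\sum_i k i *: v i) *m S) r s =
    \sum_i k i * ((r == (enum_val i).1) && (s == (enum_val i).2))%:R.
  rewrite mulmx_sumr mulmx_suml summxE; apply: eq_bigr => i _.
  rewrite -scalemxAr -scalemxAl /v !mulmxA mulVmx// mul1mx mulmxKV//.
  by rewrite !mxE.
exists X0, <<V>>%VS.
  apply/seteqP; split=> X /= hX.
    have : A *m (X - X0) + (X - X0) *m B = 0.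
      by rewrite mulmxBr mulmxBl addrACA -opprD hX e0 subrr.
    move: (X - X0) => Z /sylvester_kernelP h.
    pose Y := invmx S *m Z *m S.
    (* The coefficients are the entries of [Z] in the eigenbasis; those outside [J] vanish by
       [h]. *)
    have -> : Z = \sum_i Y (enum_val i).1 (enum_val i).2 *: v i.
      apply: (conjmx_inj uS); rewrite -/Y; apply/matrixP => r s; rewrite KE.
      rewrite -(big_enum_val (fun p => Y p.1 p.2 * ((r == p.1) && (s == p.2))%:R)).
      have [rsJ|rsJ] := boolP ((r, s) \in J).
        rewrite (bigD1 (r, s))//= !eqxx mulr1 big1 ?addr0// => -[p q] /andP[_].
        by rewrite eq_sym xpair_eqE /= => /negPf->; rewrite mulr0.
      rewrite big1 => [|[p q] /= pqJ]; first by apply: h; move: rsJ; rewrite inE.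
      case: andP => [[/eqP er /eqP es]|_]; last by rewrite mulr0.
      by rewrite er es pqJ in rsJ.
    by apply: memv_suml => i _; rewrite memvZ// -nV memv_span// mem_nth ?size_tuple.
  have : A *m (X - X0) + (X - X0) *m B = 0.
    apply/sylvester_kernelP => r s nz; rewrite (coord_span hX).
    under eq_bigr do rewrite nV.
    rewrite KE big1// => i _; case: andP => [[/eqP er /eqP es]|_]; last by rewrite mulr0.
    by have := enum_valP i; rewrite inE -er -es (negPf nz).
  by rewrite mulmxBr mulmxBl addrACA -opprD e0 => /subr0_eq.
suff /eqP -> : free V by rewrite size_tuple.
(* Each coefficient of a vanishing combination is read off as the entry at its own position. *)
apply/freeP => k; under eq_bigr do rewrite nV.
move=> e i; have := KE k (enum_val i).1 (enum_val i).2.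
rewrite e mulmx0 mul0mx mxE (bigD1 i)//= !eqxx mulr1 big1 ?addr0// => j ne.
rewrite -xpair_eqE -!surjective_pairing (inj_eq enum_val_inj).
by rewrite eq_sym (negPf ne) mulr0.
Qed.

(** The off-diagonal entries of [Z] in the eigenbasis must vanish, so [Z] is diagonal there together
    with [A] and [B]. *)
Lemma sylvester_kernel_diag Z : (forall r s, r != s -> a 0 r + b 0 s != 0) ->
  A *m Z + Z *m B = 0 ->
  [/\ diagonalizable Z, comm_mx Z A & comm_mx Z B].
Proof.
move=> nz /sylvester_kernelP h; pose T := invmx S.
have uT : T \in unitmx by rewrite unitmx_inv.
have conjT N L : invmx S *m N *m S = L -> N = invmx T *m L *m T.
  by move=> <-; rewrite invmxK !mulmxA mulmxV// mul1mx mulmxK.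
have [d dZ] : exists d, invmx S *m Z *m S = diag_mx d.
  by apply/diag_mxP/is_diag_mxP => r s rs; apply/h/nz.
rewrite (conjT _ _ dZ) (conjT _ _ eA) (conjT _ _ eB) /comm_mx !mulmx_conj//.
split; try by rewrite diag_mxC.
by apply/diagonalizable_conj; exists T => //; exists d.
Qed.
End InducedVectors.

(** * Solving linear equations with the Drazin inverse *)

Section Drazin.
Context (M : 'M[F]_n) (dM : diagonalizable M).
Let D := drazinmx M.

(** From D M D = D and D M = M D follows D = D D M. *)
Lemma drazinmx_kernel Z : M *m Z = 0 -> D *m Z = 0.
Proof.
have /is_drazinP[_ DMD DM] := drazinmxP M; rewrite -/D in DMD DM.
by move=> MZ; rewrite -DMD -[D * M * D]mulrA -DM -!mulmxA MZ !mulmx0.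
Qed.

Lemma drazinmx_solution C X : M *m X = C -> M *m (D *m C) = C.
Proof. by move=> <-; rewrite !mulmxA diagonalizable_mul_drazinmxK. Qed.

Lemma drazinmx_unit : M \in unitmx -> D = invmx M.
Proof.
move=> uM; rewrite -[LHS](mulKmx uM) -[RHS]mulmx1; congr (_ *m _).
by rewrite -[LHS](mulmxK uM) diagonalizable_mul_drazinmxK// mulmxV.
Qed.

Lemma diagonalizable_not_unit : M \notin unitmx -> exists2 Q,
  Q != 0 & M *m Q = 0 /\ forall N, comm_mx M N -> comm_mx Q N.
Proof.
(* This is the spectral projection onto the kernel of [M]; were it zero, [D] would invert [M]. *)
move=> nuM; exists (1%:M - M *m D).
  rewrite subr_eq0; apply: contra nuM => /eqP e.
  by have [] := mulmx1_unit (esym e).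
have cDM : comm_mx D M by exact: comm_drazinmx.
split=> [|N cMN].
  rewrite mulmxBr mulmx1 -cDM mulmxA.
  by rewrite diagonalizable_mul_drazinmxK// subrr.
rewrite /comm_mx mulmxBl mulmxBr mul1mx mulmx1; congr (_ - _).
by rewrite -mulmxA (comm_drazinmx dM cMN) !mulmxA cMN.
Qed.
End Drazin.
End Diagonalizable.

(** * Normal matrices and the Moore-Penrose inverse *)

Section Normal.
Context {K : numClosedFieldType} {n : nat}.
Local Open Scope sesquilinear_scope.
Implicit Types (M N P : 'M[K]_n) (d : 'rV[K]_n).

Lemma conj_diag_adj P d : P \is unitarymx ->
  (invmx P *m diag_mx d *m P)^t* = invmx P *m diag_mx (map_mx Num.conj d) *m P.
Proof.
move=> uP; rewrite invmx_unitary// !adjM trmxCK tr_diag_mx map_diag_mx.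
by rewrite mulmxA.
Qed.

(** Fuglede's theorem: by unitary diagonalization, taking the adjoint conjugates the eigenvalues, an
    instance of [comm_conj_map_diag]. *)
Lemma normalmx_comm_adj M N : M \is normalmx -> comm_mx M N -> comm_mx (M^t*) N.
Proof.
case/orthomx_spectral_subproof => -[P d] /= uP ->; rewrite conj_diag_adj//.
exact/comm_conj_map_diag/unitarymx_unit.
Qed.

Lemma comm_normalmxDM M N : M \is normalmx -> N \is normalmx -> comm_mx M N ->
  M + N \is normalmx /\ M *m N \is normalmx.
Proof.
move=> nM nN cMN; have cM'N := normalmx_comm_adj nM cMN.
have cN'M := normalmx_comm_adj nN (esym cMN).
have cM'N' : comm_mx (M^t*) (N^t*).
  exact/comm_mx_sym/(normalmx_comm_adj nN)/comm_mx_sym.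
move/normalmxP: nM => nM; move/normalmxP: nN => nN.
split; apply/normalmxP.
  rewrite linearD map_mxD /= !mulmxDl !mulmxDr nM nN -cN'M cM'N.
  by rewrite addrACA [X in _ + X]addrC addrACA.
rewrite adjM -cM'N' -!mulmxA [N *m _]mulmxA -cM'N -mulmxA nN.
by rewrite [N^t* *m (M *m N)]mulmxA cN'M !mulmxA nM.
Qed.

Lemma normal_drazinmx M : M \is normalmx ->
  drazinmx M = mpinvmx M /\ drazinmx M \is normalmx.
Proof.
case/orthomx_spectral_subproof => -[P d] /= uP ->.
have uP' := unitarymx_unit uP; rewrite drazinmx_conj_diag//; split; last first.
  by apply/orthomx_spectral_subproof; exists (P, map_mx GRing.inv d).
have e : map_mx GRing.inv (map_mx GRing.inv d) = d.
  by apply/rowP => i; rewrite !mxE invrK.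
apply/mpinvmx_unique/and4P; rewrite !mulmx_conj// !mulmx_diag !conj_diag_adj//.
rewrite -!mulmx_diag mulmx_diag_inv -{4}e mulmx_diag_inv !eqxx !mulmx_diag.
(* The two Hermitian conditions remain: d_i d_i^-1 is 0 or 1, hence fixed by conjugation. *)
split=> //; apply/eqP; congr (_ *m diag_mx _ *m _); apply/rowP => i; rewrite !mxE;
  rewrite rmorphM/= fmorphV; have [->|nz] := eqVneq (d 0 i) 0;
  by rewrite ?conjC0 ?mul0r ?mulr0// ?mulfV ?mulVf ?conjC_eq0.
Qed.
End Normal.

(** Characteristic 0 makes k |-> x + k z injective on the naturals. *)
Lemma infinite_set_line (K : numFieldType) (V : lmodType K) (A : set V) x z :
  z != 0 -> (forall k, A (x + k *: z)) -> infinite_set A.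
Proof.
move=> z0 Axz fA; apply: infinite_nat.
have -> : [set: nat] = (fun k : nat => x + k%:R *: z) @^-1` A.
  by apply/seteqP; split=> // k _; exact: Axz.
apply: finite_preimage fA => j k _ _ /addrI/eqP.
by rewrite -subr_eq0 -scalerBl scaler_eq0 (negPf z0) orbF subr_eq0 eqr_nat => /eqP.
Qed.

Theorem theorem3p1 (R : realType) (n : nat) (A B C : 'M[R[i]]_n)
    (cAB : comm_mx A B) (cAC : comm_mx A C) (cBC : comm_mx B C)
    (dA : diagonalizable A) (dB : diagonalizable B) (dC : diagonalizable C) :
  let E : set 'M[R[i]]_n := [set X | A *m X + X *m B = C] in
  let L : set 'M[R[i]]_n := [set X | (A + B) *m X = C] in
  let Xhat := drazinmx (A + B) *m C in
  [/\ [/\ diagonalizable Xhat,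
          [/\ comm_mx Xhat A, comm_mx Xhat B & comm_mx Xhat C]
        & A \is normalmx -> B \is normalmx -> C \is normalmx ->
          Xhat = mpinvmx (A + B) *m C /\ Xhat \is normalmx],
      [/\ E !=set0 <-> E Xhat,
          E !=set0 <-> L !=set0
        & E !=set0 <-> L Xhat],
      E !=set0 -> forall a b : 'rV[R[i]]_n, induced_vectors A B a b ->
        affine_dim E #|[set rs : 'I_n * 'I_n | a 0 rs.1 + b 0 rs.2 == 0]%SET| /\
        ((forall r s : 'I_n, r != s -> a 0 r + b 0 s != 0) ->
         forall X, E X -> diagonalizable X),
      A + B \in unitmx ->
        [/\ Xhat = invmx (A + B) *m C, E Xhat
          & forall X, E X -> X <> Xhat ->
              A *m X <> X *m A /\ B *m X <> X *m B]
    & E !=set0 -> A + B \notin unitmx -> infinite_set E].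
Proof.
move=> E L Xhat; set M := A + B in L Xhat *; pose D := drazinmx M.
have [dM _] := comm_diagonalizableDM cAB dA dB.
have cMA : comm_mx M A by rewrite /comm_mx mulmxDl mulmxDr cAB.
have cMB : comm_mx M B by rewrite /comm_mx mulmxDl mulmxDr cAB.
have cMC : comm_mx M C by rewrite /comm_mx mulmxDl mulmxDr cAC cBC.
have cDA := comm_drazinmx dM cMA; have cDB := comm_drazinmx dM cMB.
have cDC := comm_drazinmx dM cMC.
have [_ dX] := comm_diagonalizableDM cDC (diagonalizable_drazinmx dM) dC.
have cXA : comm_mx Xhat A by exact/comm_mx_sym/comm_mxM; exact: comm_mx_sym.
have cXB : comm_mx Xhat B by exact/comm_mx_sym/comm_mxM; exact: comm_mx_sym.
have cXC : comm_mx Xhat C by exact/comm_mx_sym/comm_mxM; exact: comm_mx_sym.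
(* [Xhat] commutes with [B], so this carries it from the standard equation back to (E) and closes
   the cycle of implications in (ii). *)
have EL X : comm_mx X B -> E X = L X.
  by move=> cXB'; rewrite /E /L /= mulmxDl [X in _ + X = _]cXB'.
have E0L : E !=set0 -> L !=set0.
  by case=> X /= /(sylvester_standard cAB cAC cBC dA dB dC).
have L0X : L !=set0 -> L Xhat by case=> X LX; exact: (drazinmx_solution dM LX).
have E0X : E !=set0 -> E Xhat by move=> /E0L/L0X; rewrite EL.
split.
- split; [exact: dX | by split | move=> nA nB nC].
  have [nM _] := comm_normalmxDM nA nB cAB.
  have [<- nD] := normal_drazinmx nM.
  by split; last exact: (comm_normalmxDM nD nC cDC).2.
- split; split.
  + exact: E0X.
  + by move=> EX; exists Xhat.
  + exact: E0L.
  + by move=> /L0X LX; exists Xhat; rewrite EL.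
  + by move/E0L/L0X.
  + by move=> LX; exists Xhat; rewrite EL.
- move=> E0 a b [S uS [eA eB]]; have EX := E0X E0.
  split=> [|nz X EXX]; first exact: (sylvester_affine_dim uS eA eB EX).
  have : A *m (X - Xhat) + (X - Xhat) *m B = 0.
    by rewrite mulmxBr mulmxBl addrACA -opprD EXX EX subrr.
  rewrite -{3}[X](subrK Xhat); move: (X - Xhat) => Z eZ.
  have [dZ cZA cZB] := sylvester_kernel_diag uS eA eB nz eZ.
  (* As [Z] commutes with [B], M Z = A Z + Z B = 0. *)
  have DZ : D *m Z = 0.
    by apply: drazinmx_kernel; rewrite mulmxDl -cZB.
  have cDZ : comm_mx D Z.
    exact/(comm_drazinmx dM)/comm_mx_sym/comm_mxD.
  (* [Z] and [Xhat] commute because both products vanish: each contains the factor D Z = 0 after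
     reordering. *)
  apply: (comm_diagonalizableDM _ dZ dX).1.
  rewrite /comm_mx /Xhat [in RHS]cDC -[in RHS]mulmxA DZ mulmx0.
  by rewrite mulmxA -cDZ DZ mul0mx.
- move=> uM; have LX : L Xhat.
    by apply: L0X; exists (invmx M *m C); rewrite /L /= mulKVmx.
  have uniqX X : L X -> X = Xhat.
    by move=> LXX; apply: (can_inj (mulKmx uM)); rewrite LXX LX.
  split; [by rewrite /Xhat (drazinmx_unit dM uM) | by rewrite EL |].
  (* Commuting with [B] turns (E) into M X = C; commuting with [A] turns it into X M = C, and Xhat M
     = C as well. Either way invertibility of [M] forces X = [Xhat]. *)
  move=> X EXX neX; split=> cX; apply: neX; last by apply: uniqX; rewrite -EL.
  apply: (can_inj (mulmxK uM)); rewrite mulmxDr -cX EXX.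
  by rewrite -[LHS]LX mulmxDl mulmxDr cXA cXB.
- move=> /E0X EX nuM; have [Q Q0 [MQ cQ]] := diagonalizable_not_unit dM nuM.
  (* [Q] commutes with [B], so A Q + Q B = M Q = 0 and the whole line through [Xhat] along [Q]
     solves (E). *)
  apply: (infinite_set_line (x := Xhat) Q0) => k.
  rewrite /E /= mulmxDr mulmxDl addrACA EX -scalemxAr -scalemxAl (cQ _ cMB).
  by rewrite -scalerDr -mulmxDl MQ scaler0 addr0.
Qed.
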